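(* For every axial integer $n$ (i.e. such that there is at least one self-conjugate partition of $n$) with $1\le n\le 30$, one has $$\rho_{\deg}^{\mathrm{ax}}(n)\le 2,\qquad \rho_{\deg}^{\mathrm{sp}}(n)\le 2,$$ and $$\rho_{\omega}^{\mathrm{ax}}(n),\ \rho_{\omega}^{\mathrm{sp}}(n),\ \rho_{\dim}^{\mathrm{ax}}(n),\ \rho_{\dim}^{\mathrm{sp}}(n)\le 4,$$ where the subscripts $\omega$ and $\dim$ refer to the vertex invariants $\omega_{\mathrm{loc}}$ and $\dim_{\mathrm{loc}}$ of the partition graph $G_n$, and $\deg$ is the vertex degree in $G_n$.
   Context: Partition graph: $G_n$ is the simple graph whose vertices are the partitions of $n$, written $\lambda=(\lambda_1\ge\dots\ge\lambda_\ell\ge1)$. Two distinct partitions $\lambda,\mu$ of $n$ are adjacent if $\mu$ is obtained from $\lambda$ by an elementary transfer: decrease one part of $\lambda$ by $1$, increase a different part by $1$ (the receiving part may be a newly adjoined zero part), delete a zero part if necessary, and reorder into nonincreasing form. $N_{G_n}(\alpha)$ is the set of neighbors of $\alpha$, $d_{G_n}$ is graph distance, and $d_{G_n}(\lambda,S)=\min_{\alpha\in S}d_{G_n}(\lambda,\alpha)$. $\lambda'$ is the conjugate partition of $\lambda$. Axis and central regions: $\mathrm{Ax}_n=\{\lambda\vdash n:\lambda=\lambda'\}$; $n$ is axial if $\mathrm{Ax}_n\ne\varnothing$; $C_n^{(r)}=\{\lambda\in V(G_n): d_{G_n}(\lambda,\mathrm{Ax}_n)\le r\}$. Thin and thick spine: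 the axial interaction graph $\mathcal A_n$ has vertex set $\mathrm{Ax}_n$, with distinct $\alpha,\beta$ adjacent iff $M(\alpha,\beta):=N_{G_n}(\alpha)\cap N_{G_n}(\beta)\ne\varnothing$. The thin spine is $\mathrm{Sp}_n=\mathrm{Ax}_n\cup\bigcup_{\{\alpha,\beta\}\in E(\mathcal A_n)}M(\alpha,\beta)$, and $\mathrm{Sp}_n^{(r)}=\{\lambda\in V(G_n): d_{G_n}(\lambda,\mathrm{Sp}_n)\le r\}$. Local invariants: $\omega_{\mathrm{loc}}(v)=\max\{|Q|: Q\text{ is a clique in }G_n\text{ and }v\in Q\}$ and $\dim_{\mathrm{loc}}(v)=\omega_{\mathrm{loc}}(v)-1$. Concentration radii: for $I:V(G_n)\to\mathbb R$, $\operatorname{Argmax}(I)=\{\lambda\in V(G_n): I(\lambda)=\max_{\mu\in V(G_n)}I(\mu)\}$; $\rho_I^{\mathrm{ax}}(n)=\min\{r\ge0:\operatorname{Argmax}(I)\subseteq C_n^{(r)}\}$ and $\rho_I^{\mathrm{sp}}(n)=\min\{r\ge0:\operatorname{Argmax}(I)\subseteq \mathrm{Sp}_n^{(r)}\}$, with $r$ ranging over nonnegative integers. *)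

(* Defs.v *)
From HB Require Import structures.
From mathcomp Require Import all_boot.

Set Implicit Arguments.
Unset Strict Implicit.
Unset Printing Implicit Defensive.

Section FiniteGraph.

Variables (T : finType) (e : rel T).

Definition nbhd (x : T) : {set T} := [set y | e x y].

Definition degree (x : T) : nat := #|nbhd x|.

(* Least number of edges of a walk from x to y.  A shortest walk has fewer
   than #|T| edges, so the value #|T| means that there is no walk at all. *)
Definition gdist (x y : T) : nat :=
  \big[minn/#|T|]_(k < #|T|
      | [exists p : k.-tuple T, path e x p && (last x p == y)]) k.

(* The value is #|T| if S is empty. *)
Definition gdist_set (x : T) (S : {set T}) : nat :=
  \big[minn/#|T|]_(y in S) gdist x y.

Definition thicken (S : {set T}) (r : nat) : {set T} :=
  [set x | gdist_set x S <= r].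

Definition clique (Q : {set T}) : bool :=
  [forall x in Q, forall y in Q, (x != y) ==> e x y].

Definition omega_loc (x : T) : nat :=
  \max_(Q : {set T} | clique Q && (x \in Q)) #|Q|.

(* Singletons are cliques, so omega_loc x >= 1 and no truncation occurs. *)
Definition dim_loc (x : T) : nat := omega_loc x - 1.

Definition argmax (f : T -> nat) : {set T} := [set x | f x == \max_y f y].

Lemma thicken_full (A S : {set T}) : exists r, A \subset thicken S r.
Proof.
exists #|T|; apply/subsetP => x _; rewrite inE /gdist_set.
by elim/big_rec: _ => // y m _ le_m; rewrite geq_min le_m orbT.
Qed.

Definition radius (S : {set T}) (f : T -> nat) : nat :=
  ex_minn (thicken_full (argmax f) S).

End FiniteGraph.

Definition is_partition (n : nat) (s : seq nat) : bool :=
  [&& sorted geq s, 0 \notin s & sumn s == n].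

Record partition_of (n : nat) := PartitionOf {
  parts :> seq nat;
  parts_subproof : is_partition n parts
}.

HB.instance Definition _ (n : nat) := [isSub for @parts n].
HB.instance Definition _ (n : nat) := [Countable of partition_of n by <:].

Section PartitionFinite.

Variable n : nat.

Let encode (l : partition_of n) : n.-bseq 'I_n.+1 :=
  insub_bseq n [seq inord x | x <- parts l].

Let decode (t : n.-bseq 'I_n.+1) : option (partition_of n) :=
  insub [seq val i | i <- t].

Lemma encodeK : pcancel encode decode.
Proof.
case=> s s_part; have /and3P[_ s_pos /eqP s_sum] := s_part.
have le_size : size s <= n.
  rewrite -s_sum; elim: s s_pos {s_part s_sum} => //= x s IHs.
  rewrite inE negb_or eq_sym -lt0n => /andP[x_gt0 /IHs le_s].
  by rewrite -add1n leq_add.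
have le_part x : x \in s -> x <= n.
  rewrite -s_sum; elim: s {s_pos s_part s_sum le_size} => //= y s IHs.
  rewrite inE => /predU1P[-> | /IHs le_x]; first exact: leq_addr.
  exact: leq_trans le_x (leq_addl _ _).
rewrite /decode /encode /insub_bseq /= val_insubd size_map le_size -map_comp.
rewrite map_id_in; last by move=> x /le_part le_x; rewrite /= inordK.
by rewrite insubT.
Qed.

HB.instance Definition _ : isFinite (partition_of n) := PCanIsFinite encodeK.

End PartitionFinite.

(* Move one unit from part i to part j.  For j = size s, set_nth adjoins a
   new part; a part that becomes zero is deleted. *)
Definition transfer (i j : nat) (s : seq nat) : seq nat :=
  let t := set_nth 0 (set_nth 0 s i (nth 0 s i).-1) j (nth 0 s j).+1 in
  sort geq [seq x <- t | x != 0].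

Definition partition_adj (n : nat) : rel (partition_of n) := fun l m =>
  (l != m) &&
  [exists i : 'I_(size l), exists j : 'I_(size l).+1,
     (i != j :> nat) && (parts m == transfer i j l)].

Definition conjugate (s : seq nat) : seq nat :=
  [seq count (fun x => i < x) s | i <- iota 0 (head 0 s)].

Definition axis (n : nat) : {set partition_of n} :=
  [set l : partition_of n | conjugate l == parts l].

Definition axial (n : nat) : bool := axis n != set0.

Definition middle (n : nat) (a b : partition_of n) : {set partition_of n} :=
  nbhd (@partition_adj n) a :&: nbhd (@partition_adj n) b.

Definition axial_adj (n : nat) : rel (partition_of n) := fun a b =>
  [&& a \in axis n, b \in axis n, a != b & middle a b != set0].

Definition thin_spine (n : nat) : {set partition_of n} :=
  axis n :|: \bigcup_(p : partition_of n * partition_of n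
                       | axial_adj p.1 p.2) middle p.1 p.2.

Definition rho_ax (n : nat) (f : partition_of n -> nat) : nat :=
  radius (@partition_adj n) (axis n) f.

Definition rho_sp (n : nat) (f : partition_of n -> nat) : nat :=
  radius (@partition_adj n) (thin_spine n) f.

(* Main.v *)
(* Moving a box off a row of length x onto a row of length y shortens column
   x - 1 of the diagram by one and lengthens column y by one (columns being
   numbered from 0).  Hence the neighbors of a partition s correspond to pairs
   (x, y) with x in D, y in D or 0, x <> y + 1, and x repeated in s if x = y,
   where D is the set of parts of s, and two neighbors can be adjacent only if
   their pairs share a coordinate.  The neighborhood of s is thus a subgraph of
   a rook graph: the degree is at most the number of pairs, and a clique
   through s has at most one vertex more than some line of the grid.  If D has
   k elements, these bounds are at most k (k + 1) and k + 2.  Explicit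
   partitions and cliques bound the maximal invariants from below, so that
   every maximizer has many distinct parts; for n <= 30 few partitions have,
   and for each of them that the bounds do not exclude, greedy transfers reach
   a self-conjugate partition in 2 or 4 steps. *)
Require Import Defs.
From mathcomp Require Import all_boot zify.

Set Implicit Arguments.
Unset Strict Implicit.
Unset Printing Implicit Defensive.

(** * Minima, cliques and radii in finite graphs *)

Lemma bigmin_leq (I : finType) (P : pred I) (F : I -> nat) (m : nat) (i : I) :
  P i -> \big[minn/m]_(j | P j) F j <= F i.
Proof.
have := mem_index_enum i; rewrite unlock; elim: (index_enum I) => //= j r IHr.
rewrite inE => /predU1P[<- -> | /IHr{}IHr Pi]; first exact: geq_minl.
by case: ifP => _; rewrite ?geq_min IHr ?orbT.
Qed.

Lemma bigmin_leq_id (I : finType) (P : pred I) (F : I -> nat) (m : nat) :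
  \big[minn/m]_(j | P j) F j <= m.
Proof. by elim/big_rec: _ => // i k _ le_km; rewrite geq_min le_km orbT. Qed.

Lemma card_leq_size (T : finType) (U : eqType) (A : {set T}) (g : T -> U)
    (r : seq U) :
  {in A &, injective g} -> (forall t, t \in A -> g t \in r) -> #|A| <= size r.
Proof.
move=> g_inj gA; rewrite cardE -(size_map g); apply: uniq_leq_size.
  rewrite map_inj_in_uniq ?enum_uniq // => t u.
  by rewrite !mem_enum; apply: g_inj.
by move=> _ /mapP[t + ->]; rewrite mem_enum => /gA.
Qed.

(** If [t] and [u] differ under [f], no [v] can agree under [f] with both, so each [v] has the
    common [g]-value of [t] and [u]. *)
Lemma rook_clique (T : finType) (U V : eqType) (A : {set T})
    (f : T -> U) (g : T -> V) :
  {in A &, forall t u, f t = f u \/ g t = g u} ->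
  {in A &, forall t u, f t = f u} \/ {in A &, forall t u, g t = g u}.
Proof.
move=> sh; case: (boolP [forall t in A, forall u in A, f t == f u]).
  move/forall_inP=> eqf; left=> t u At Au.
  by apply/eqP/(forall_inP (eqf t At)).
rewrite negb_forall_in => /exists_inP[t At]; rewrite negb_forall_in.
case/exists_inP=> u Au /eqP neq_tu; right.
have gtu : g t = g u by case: (sh t u At Au).
suff eqg v : v \in A -> g v = g t by move=> v w Av Aw; rewrite !eqg.
move=> Av; case: (sh v t Av At) => // fvt.
by case: (sh v u Av Au) => [fvu | ->] //; case: neq_tu; rewrite -fvt.
Qed.

Section Graph.

Variables (T : finType) (e : rel T).

Lemma gdist_le_path (x : T) (p : seq T) :
  path e x p -> gdist e x (last x p) <= size p.
Proof.
move=> xp; rewrite /gdist; case: (ltnP (size p) #|T|) => lt_p.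
  apply: (@bigmin_leq _ _ (fun k : 'I_#|T| => val k) #|T| (Ordinal lt_p)).
  by apply/existsP; exists (in_tuple p); rewrite /= xp eqxx.
(* A longer path is no shorter than the default value [#|T|] of the minimum. *)
exact: leq_trans (bigmin_leq_id _ _ _) lt_p.
Qed.

Lemma radius_le (S : {set T}) (f : T -> nat) (r : nat) :
  (forall x, (forall y, f y <= f x) -> exists2 y, y \in S & gdist e x y <= r) ->
  radius e S f <= r.
Proof.
move=> near; rewrite /radius; case: ex_minnP => m _; apply.
apply/subsetP=> x; rewrite !inE => /eqP fx; case: (near x) => [y | y Sy le_r].
  by rewrite fx; apply: leq_bigmax.
exact: leq_trans (bigmin_leq _ _ Sy) le_r.
Qed.

Lemma omega_loc_gt0 (x : T) : 0 < omega_loc e x.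
Proof.
rewrite -(cards1 x); apply: (bigmax_sup [set x]) => //; rewrite set11 andbT.
by apply/forall_inP=> y /set1P->; apply/forall_inP=> z /set1P->; rewrite eqxx.
Qed.

(** As [omega_loc] is positive, subtracting 1 never truncates, so both invariants have the same
    maximizers. *)
Lemma dim_loc_le (x y : T) :
  (dim_loc e x <= dim_loc e y) = (omega_loc e x <= omega_loc e y).
Proof.
by have := omega_loc_gt0 x; have := omega_loc_gt0 y; rewrite /dim_loc; lia.
Qed.

End Graph.

(** * Transfers and their effect on column lengths *)

Lemma geq_trans : transitive geq.
Proof. by move=> y x z; rewrite /geq /= => yx zy; apply: leq_trans zy yx. Qed.

Lemma geq_total : total geq.
Proof. by move=> x y; rewrite /geq /= leq_total. Qed.

Lemma sumn_filter_neq0 (s : seq nat) : sumn [seq x <- s | x != 0] = sumn s.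
Proof. by elim: s => //= x s IHs; case: eqP => [-> | _] /=; rewrite IHs. Qed.

Lemma leq_nth_sumn (s : seq nat) (i : nat) : nth 0 s i <= sumn s.
Proof.
elim: s i => [|x s IHs] [|i] //=; first exact: leq_addr.
exact: leq_trans (IHs i) (leq_addl _ _).
Qed.

Lemma sumn_set_nthD (s : seq nat) (i x : nat) :
  sumn (set_nth 0 s i x) + nth 0 s i = sumn s + x.
Proof. by rewrite sumn_set_nth0; have := leq_nth_sumn s i; lia. Qed.

(** Both the padding of [set_nth] and the default of [nth] are 0, hence the condition on [a]. *)
Lemma count_set_nthD (a : pred nat) (s : seq nat) (i x : nat) :
  ~~ a 0 -> count a (set_nth 0 s i x) + a (nth 0 s i) = count a s + a x.
Proof.
move=> a0; rewrite count_set_nthF //; suff: a (nth 0 s i) <= count a s by lia.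
case: (ltnP i (size s)) => [lt_i | ge_i]; last first.
  by rewrite nth_default // (negPf a0).
case: (boolP (a _)) => // a_i; rewrite -has_count.
by apply/hasP; exists (nth 0 s i) => //; apply: mem_nth.
Qed.

Lemma nth_gt0 (s : seq nat) (i : nat) :
  0 \notin s -> i < size s -> 0 < nth 0 s i.
Proof.
move=> s_pos lt_i; rewrite lt0n; apply: contraNneq s_pos => <-.
exact: mem_nth.
Qed.

Lemma transfer_partition (n : nat) (s : seq nat) (i j : nat) :
  is_partition n s -> i < size s -> i != j -> is_partition n (transfer i j s).
Proof.
case/and3P=> _ s_pos /eqP s_sum lt_i neq_ij; rewrite /is_partition /transfer.
rewrite sort_sorted ?mem_sort ?mem_filter ?eqxx //=; last exact: geq_total.
rewrite (perm_sumn (permEl (perm_sort _ _))) sumn_filter_neq0.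
have := sumn_set_nthD s i (nth 0 s i).-1; set u := set_nth 0 s i _ => sum_u.
have := sumn_set_nthD u j (nth 0 s j).+1; have := nth_gt0 s_pos lt_i.
by rewrite [nth 0 u j]nth_set_nth /= [j == i]eq_sym (negPf neq_ij) -s_sum; lia.
Qed.

(* The length of column k of the diagram, columns being numbered from 0. *)
Definition column (s : seq nat) (k : nat) : nat := count (fun x => k < x) s.

(** The multiplicity of the part k + 1 is the drop in length from column k to column k + 1. *)
Lemma column_inj (n : nat) (s t : partition_of n) :
  column s =1 column t -> s = t.
Proof.
move=> eq_col; apply: val_inj => /=.
have /and3P[s_sorted s_pos _] := valP s.
have /and3P[t_sorted t_pos _] := valP t.
apply: (sorted_eq geq_trans) => //; first by move=> x y; rewrite /geq /=; lia.
apply/allP=> x _ /=; apply/eqP; case: x => [|k].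
  by rewrite !(count_memPn _).
have colS (u : seq nat) : count_mem k.+1 u + column u k.+1 = column u k.
  by rewrite /column; elim: u => //= y u IHu; lia.
apply: (@addIn (column s k.+1)); rewrite [in RHS]eq_col.
by apply: (etrans (colS s)); rewrite eq_col; apply/esym/colS.
Qed.

(* [moved s t x y]: t is obtained by taking one box off a row of length x of s
   and putting it on another row, of length y. *)
Definition moved (s t : seq nat) (x y : nat) : Prop :=
  [/\ 0 < x, x != y.+1 &
      forall k, column t k + (k.+1 == x) = column s k + (k == y)].

Definition movable (s : seq nat) (x y : nat) : bool :=
  (x != y.+1) && ((x == y) ==> (1 < count_mem x s)).

Lemma column_transfer (s : seq nat) (i j k : nat) :
  0 \notin s -> i < size s -> i != j ->
  column (transfer i j s) k + (k.+1 == nth 0 s i)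
    = column s k + (k == nth 0 s j).
Proof.
move=> s_pos lt_i neq_ij; rewrite /column /transfer count_sort count_filter.
rewrite (eq_count (a2 := fun x => k < x)); last first.
  by case=> //= x; rewrite andbT.
pose a x := k < x.
have := count_set_nthD (a := a) s i (nth 0 s i).-1 isT.
set u := set_nth 0 s i _ => count_u; have := nth_gt0 s_pos lt_i.
have := count_set_nthD (a := a) u j (nth 0 s j).+1 isT.
rewrite [nth 0 u j]nth_set_nth /= [j == i]eq_sym (negPf neq_ij) /a in count_u *.
lia.
Qed.

Lemma adj_moved (n : nat) (s t : partition_of n) : partition_adj s t ->
  exists x y, [/\ x \in undup s, y \in 0 :: undup s, movable s x y
                & moved s t x y].
Proof.
case/andP=> neq_st /existsP[i /existsP[j /andP[neq_ij /eqP t_def]]].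
have /and3P[_ s_pos _] := valP s.
have s_i := nth_gt0 s_pos (ltn_ord i).
have colE k := column_transfer k s_pos (ltn_ord i) neq_ij.
rewrite -t_def in colE; exists (nth 0 s i), (nth 0 s j).
(* Moving a box from a row of length y + 1 to one of length y only swaps the two lengths. *)
have neq_xy : nth 0 s i != (nth 0 s j).+1.
  apply: contraNneq neq_st => eq_xy; apply/eqP/column_inj => k.
  by apply: (@addIn (k == nth 0 s j)); rewrite -colE eq_xy eqSS.
split=> //; first by rewrite mem_undup mem_nth.
  rewrite inE mem_undup; case: (ltnP j (size s)) => [lt_j | ge_j].
    by rewrite mem_nth ?orbT.
  by rewrite nth_default.
rewrite /movable neq_xy /=; apply/implyP=> /eqP eq_xy.
(* If both lengths are equal, row [j] still has length x after row [i] is zeroed, so x occurs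
   twice. *)
have neq0 : 0 != nth 0 s i by rewrite neq_ltn s_i.
have := count_set_nthD (a := pred1 (nth 0 s i)) s i 0 neq0.
rewrite /= eqxx (negPf neq0).
rewrite addn1 addn0 => <-; rewrite ltnS.
rewrite -has_count has_pred1; have -> : nth 0 s i = nth 0 (set_nth 0 s i 0) j.
  by rewrite nth_set_nth /= [_ == val i]eq_sym (negPf neq_ij).
apply: mem_nth; rewrite size_set_nth leq_max; apply/orP; right.
by case: (ltnP j (size s)) => // ge_j; rewrite eq_xy nth_default in s_i.
Qed.

(** Choosing one pair per neighbor gives a map into the grid, injective by [moved_inj]; (0, 0) is a
    dummy value elsewhere. *)
Lemma moves (n : nat) (s : partition_of n) :
  exists g : partition_of n -> nat * nat,
  forall t, t \in nbhd (@partition_adj n) s ->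
    [/\ (g t).1 \in undup s, (g t).2 \in 0 :: undup s,
        movable s (g t).1 (g t).2 & moved s t (g t).1 (g t).2].
Proof.
suff ex_g t : exists p, t \in nbhd (@partition_adj n) s ->
    [/\ p.1 \in undup s, p.2 \in 0 :: undup s, movable s p.1 p.2
      & moved s t p.1 p.2] by have [g gP] := fin_all_exists ex_g; exists g.
case: (boolP (partition_adj s t)) => [/adj_moved[x [y xy]] | /negPf nadj].
  by exists (x, y).
by exists (0, 0); rewrite inE nadj.
Qed.

Lemma moved_inj (n : nat) (s t u : partition_of n) (x y : nat) :
  moved s t x y -> moved s u x y -> t = u.
Proof.
case=> _ _ mt [_ _ mu]; apply: column_inj => k.
by apply: (addIn (etrans (mt k) _)); rewrite mu.
Qed.

(* The moves s -> t and t -> u compose to the single move s -> u, so one end of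
   the second must cancel one end of the first. *)
Lemma moved_triangle (s t u : seq nat) (x y x' y' v w : nat) :
  moved s t x y -> moved s u x' y' -> moved t u v w -> x = x' \/ y = y'.
Proof.
case=> + neq_xy mt [_ neq_xy' mu] [_ _ mtu].
case: x => // x in neq_xy mt * => _.
have E k : (k == y') + (k == x) + (k.+1 == v)
    = (k == y) + (k == w) + (k.+1 == x').
  by have := mt k; have := mu k; have := mtu k; rewrite eqSS; lia.
case: (eqVneq x.+1 x') => [| neq_xx']; first by left.
case: (eqVneq y y') => [| neq_yy']; first by right.
(* With both coordinates distinct, column x forces w = x, and then column y' counts more on the left
   than on the right. *)
rewrite eqSS in neq_xy; have := E y'; have := E x.
rewrite !eqxx [y' == y]eq_sym [y'.+1 == x']eq_sym.
rewrite (negPf neq_xy) (negPf neq_xy') (negPf neq_xx') (negPf neq_yy').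
case: (eqVneq x w) => [<- | _]; last by case: (x == y').
by rewrite [y' == x]eq_sym; case: (x == y') => //; case: (y'.+1 == v).
Qed.


(** * Upper bounds from the grid of moves *)

Definition row_bound (s : seq nat) (x : nat) : nat :=
  count (movable s x) (0 :: undup s).

Definition degree_bound (s : seq nat) : nat :=
  sumn [seq row_bound s x | x <- undup s].

(** The base value bounds the lines with fixed second coordinate; the list counts those with fixed
    first coordinate. *)
Definition line_bound (s : seq nat) : nat :=
  foldr maxn (size (undup s)) [seq row_bound s x | x <- undup s].

Lemma degree_le (n : nat) (s : partition_of n) :
  degree (@partition_adj n) s <= degree_bound s.
Proof.
have [g gP] := moves s; pose D := undup s.
pose r := [seq (x, y) | x <- D, y <- filter (movable s x) (0 :: D)].
apply: (@leq_trans (size r)).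
  apply: (card_leq_size (g := g)) => [t u | t /gP].
    move=> /gP[_ _ _ mt] /gP[_ _ _ mu] eq_g.
    by apply: moved_inj mt _; rewrite eq_g.
  move=> [g1 g2 g12 _]; apply/allpairsPdep; exists (g t).1, (g t).2.
  by rewrite mem_filter g12 -surjective_pairing.
by rewrite size_allpairs_dep; under eq_map => x do rewrite size_filter.
Qed.

Lemma line_bound_ge_size (s : seq nat) : size (undup s) <= line_bound s.
Proof.
by rewrite /line_bound; elim: map => //= x r IHr; rewrite leq_max IHr orbT.
Qed.

Lemma line_bound_ge_row (s : seq nat) (x : nat) :
  x \in undup s -> row_bound s x <= line_bound s.
Proof.
move/(map_f (row_bound s)); rewrite /line_bound; elim: map => //= y r IHr.
by rewrite inE leq_max => /predU1P[-> | /IHr->]; rewrite ?leqnn ?orbT.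
Qed.

Lemma omega_loc_le (n : nat) (s : partition_of n) :
  omega_loc (@partition_adj n) s <= (line_bound s).+1.
Proof.
apply/bigmax_leqP => Q /andP[/forall_inP Q_clique Qs].
rewrite (cardsD1 s) Qs add1n ltnS; set A := Q :\ s.
have [g gP] := moves s.
have {}gP t : t \in A -> [/\ (g t).1 \in undup s, (g t).2 \in 0 :: undup s,
    movable s (g t).1 (g t).2 & moved s t (g t).1 (g t).2].
  case/setD1P=> neq_ts Qt; apply: gP; rewrite inE.
  by have /forall_inP/(_ t Qt)/implyP := Q_clique s Qs; apply; rewrite eq_sym.
have g_inj : {in A &, injective g}.
  move=> t u /gP[_ _ _ mt] /gP[_ _ _ mu] eq_g.
  by apply: moved_inj mt _; rewrite eq_g.
have [t At | A0] := pickP (mem A); last by rewrite eq_card0.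
have /rook_clique[eq1 | eq2] :
    {in A &, forall t u, (g t).1 = (g u).1 \/ (g t).2 = (g u).2}.
- move=> u v Au Av; have [-> | neq_uv] := eqVneq u v; first by left.
  have [[_ _ _ mu] [_ _ _ mv]] := (gP u Au, gP v Av).
  have Qu : u \in Q by case/setD1P: Au.
  have Qv : v \in Q by case/setD1P: Av.
  have /forall_inP/(_ v Qv)/implyP/(_ neq_uv)/adj_moved := Q_clique u Qu.
  by case=> [x [y [_ _ _]]]; apply: moved_triangle mu mv.
- have [g1t _ _ _] := gP t At.
  apply: leq_trans (line_bound_ge_row g1t); rewrite /row_bound -size_filter.
  apply: (card_leq_size (g := fun u => (g u).2)) => [u v Au Av eq2 | u Au].
    by apply: g_inj => //; apply: injective_projections; rewrite ?(eq1 u v).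
  by have [_ g2 mov _] := gP u Au; rewrite mem_filter (eq1 t u) ?mov.
- apply: leq_trans (line_bound_ge_size s).
  apply: (card_leq_size (g := fun u => (g u).1)) => [u v Au Av eq1 | u /gP[]//].
  by apply: g_inj => //; apply: injective_projections; rewrite ?(eq2 u v).
Qed.

(** * Enumeration of partitions with many distinct parts *)

Fixpoint triangle (d : nat) : nat := if d is d'.+1 then d + triangle d' else 0.

Lemma triangle_homo : {homo triangle : d e / d <= e}.
Proof.
move=> d e le_de; elim: e d le_de => [|e IHe] [|d] //= le_de.
by apply: leq_add (IHe d le_de).
Qed.

Lemma triangle_leq_sumn (s : seq nat) :
  uniq s -> 0 \notin s -> triangle (size s) <= sumn s.
Proof.
(* For the induction: the i-th entry of an increasing list above m is at least m + i. *)
have tri m r : path ltn m r -> m * size r + triangle (size r) <= sumn r.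
  elim: r m => [|x r IHr] m /=; first by rewrite muln0.
  by case/andP=> lt_mx /IHr; nia.
move=> s_uniq s_pos; have /permPl perm_s := perm_sort leq s.
rewrite -(perm_size perm_s) -(perm_sumn perm_s).
rewrite -[X in X <= _]add0n -(mul0n (size (sort leq s))).
apply: tri; rewrite path_min_sorted.
  rewrite ltn_sorted_uniq_leq sort_uniq s_uniq sort_sorted //.
  exact: leq_total.
apply/allP=> x; rewrite mem_sort /= lt0n => s_x.
by apply: contraNneq s_pos => <-.
Qed.

Lemma leq_sumn_undup (s : seq nat) : sumn (undup s) <= sumn s.
Proof.
elim: s => //= x s IHs; case: ifP => _ /=; last by rewrite leq_add2l.
exact: leq_trans IHs (leq_addl _ _).
Qed.

(* The partitions of r into parts at most k, with at least d distinct ones;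
   branches with too small an r for that are cut. *)
Fixpoint partitions (k r d : nat) : seq (seq nat) :=
  if r < triangle d then [::] else
  if k is k'.+1 then
    partitions k' r d ++
    flatten [seq [seq nseq m k ++ s | s <- partitions k' (r - m * k) d.-1]
            | m <- iota 1 (r %/ k)]
  else if r == 0 then [:: [::]] else [::].

Lemma partitionsS (k r d : nat) :
  partitions k.+1 r d = if r < triangle d then [::] else
    partitions k r d ++
    flatten [seq [seq nseq m k.+1 ++ s | s <- partitions k (r - m * k.+1) d.-1]
            | m <- iota 1 (r %/ k.+1)].
Proof. by []. Qed.

Lemma mem_partitions (k d : nat) (s : seq nat) :
  sorted geq s -> 0 \notin s -> all (fun x => x <= k) s ->
  d <= size (undup s) -> s \in partitions k (sumn s) d.
Proof.
elim: k d s => [|k IHk] d s s_sorted s_pos s_le le_d.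
  have s0 : s = [::].
    case: s s_pos s_le {s_sorted le_d} => //= x s; rewrite inE negb_or.
    by case: x.
  by move: le_d; rewrite s0; case: d.
have le_tri : triangle d <= sumn s.
  apply: leq_trans (leq_sumn_undup s).
  have := @triangle_leq_sumn (undup s) (undup_uniq s); rewrite mem_undup.
  by move/(_ s_pos); apply: leq_trans; apply: triangle_homo.
rewrite partitionsS ltnNge le_tri /=.
(* Split off the [m] copies of the largest allowed part; the rest [t] has parts at most [k]. *)
rewrite mem_cat; pose m := count_mem k.+1 s; pose t := filter (predC1 k.+1) s.
have s_def : s = nseq m k.+1 ++ t.
  apply: (sorted_eq geq_trans) => //; first by move=> x y; rewrite /geq /=; lia.
    rewrite (sorted_pairwise geq_trans) pairwise_cat.
    rewrite -!(sorted_pairwise geq_trans).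
    rewrite sorted_filter ?andbT //; last exact: geq_trans.
    apply/andP; split; last first.
      by elim: m => //= l; case: l => //= l ->; rewrite /geq /= leqnn.
    apply/allrelP=> x y /nseqP[-> _]; rewrite mem_filter /geq /= => /andP[_].
    by move/allP: s_le; apply.
  rewrite -(perm_filterC (pred1 k.+1) s) perm_cat2r.
  by rewrite (all_pred1P _ _ (filter_all (pred1 k.+1) s)) size_filter.
have t_le : all (fun x => x <= k) t.
  apply/allP=> x; rewrite mem_filter /= => /andP[neq_x /(allP s_le)].
  by rewrite leq_eqVlt (negPf neq_x).
have t_sorted : sorted geq t by apply: sorted_filter => //; apply: geq_trans.
have t_pos : 0 \notin t by rewrite mem_filter (negPf s_pos) andbF.
have t_sum : sumn t = sumn s - m * k.+1.
  by rewrite [in RHS]s_def sumn_cat sumn_nseq mulnC addKn.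
have [m0 | m_gt0] := posnP m.
  have <- : t = s by rewrite [RHS]s_def m0.
  apply/orP; left; apply: IHk => //.
  by rewrite -[t]/(nseq 0 k.+1 ++ t) -m0 -s_def.
apply/orP; right; apply/flatten_mapP; exists m.
  rewrite mem_iota m_gt0 add1n ltnS leq_divRL // [in leqRHS]s_def sumn_cat.
  by rewrite sumn_nseq mulnC leq_addr.
apply/mapP; exists t => //; rewrite -t_sum; apply: IHk => //.
(* Removing all copies of one value loses at most one distinct part. *)
apply: (@leq_trans (size (undup s)).-1); first by rewrite -!subn1 leq_sub2r.
rewrite -subn1 leq_subLR add1n -[X in _ <= X]/(size (k.+1 :: undup t)).
apply: uniq_leq_size (undup_uniq s) _ => x.
rewrite mem_undup inE mem_undup mem_filter /=.
by case: eqP.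
Qed.

(** * Bounds in terms of the number of distinct parts *)

Lemma row_bound_le (s : seq nat) (x : nat) :
  row_bound s x <= (size (undup s)).+1.
Proof. exact: count_size. Qed.

Lemma degree_bound_le (s : seq nat) :
  degree_bound s <= size (undup s) * (size (undup s)).+1.
Proof.
rewrite /degree_bound; elim: {1 2}(undup s) => //= x r IHr.
by rewrite mulSn leq_add ?row_bound_le.
Qed.

Lemma line_bound_le (s : seq nat) : line_bound s <= (size (undup s)).+1.
Proof.
rewrite /line_bound; elim: {2}(undup s) => //= x r IHr.
by rewrite geq_max row_bound_le.
Qed.

(** * Lower bounds and short paths, computed on plain sequences *)

Definition neighbors (s : seq nat) : seq (seq nat) :=
  undup [seq t <- [seq transfer i j s | i <- iota 0 (size s),
                                        j <- rem i (iota 0 (size s).+1)]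
        | t != s].

Lemma transfer_adj (n : nat) (s t : partition_of n) (i j : nat) :
  i < size s -> j < (size s).+1 -> i != j -> parts t = transfer i j s ->
  s != t -> partition_adj s t.
Proof.
move=> lt_i lt_j neq_ij t_def neq_st; rewrite /partition_adj neq_st.
apply/existsP; exists (Ordinal lt_i); apply/existsP; exists (Ordinal lt_j).
by rewrite neq_ij t_def eqxx.
Qed.

Lemma degree_ge (n : nat) (s : partition_of n) :
  size (neighbors s) <= degree (@partition_adj n) s.
Proof.
rewrite /degree cardE -(size_map (@parts n)).
apply: uniq_leq_size (undup_uniq _) _ => t; rewrite mem_undup mem_filter.
case/andP=> neq_ts /allpairsPdep[i [j [+ + t_def]]].
rewrite mem_iota add0n mem_rem_uniq ?iota_uniq // => lt_i.
case/andP; rewrite mem_iota add0n /= eq_sym => neq_ij lt_j.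
have t_part : is_partition n t.
  by rewrite t_def; apply: transfer_partition (valP s) lt_i neq_ij.
apply/mapP; exists (PartitionOf t_part) => //; rewrite mem_enum inE.
apply: (@transfer_adj _ _ _ i j) => //.
by rewrite eq_sym -val_eqE.
Qed.

(* Whether at most r transfers lead from s to t, when each of them goes from
   the last part of s exceeding its counterpart in t to the first part of s
   smaller than its counterpart in t. *)
Fixpoint reachable (r : nat) (s t : seq nat) : bool :=
  (s == t) ||
  (if r is r'.+1 then
     let k := maxn (size s) (size t) in
     let i := k - (find (fun i => nth 0 t i < nth 0 s i) (rev (iota 0 k))).+1 in
     let j := find (fun j => nth 0 s j < nth 0 t j) (iota 0 k) in
     [&& i < size s, j < (size s).+1, i != j & reachable r' (transfer i j s) t]
   else false).

Lemma reachable_path (n r : nat) (s t : partition_of n) : reachable r s t ->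
  exists p, [/\ path (@partition_adj n) s p, last s p = t & size p <= r].
Proof.
elim: r s => [|r IHr] s /=; case/orP=> [/eqP eq_st | //].
- by exists [::]; split=> //; apply: val_inj.
- by exists [::]; split=> //; apply: val_inj.
set i := _ - _; set j := find _ _ => /and4P[lt_i lt_j neq_ij].
have u_part := transfer_partition (valP s) lt_i neq_ij.
case/(IHr (PartitionOf u_part)) => p [path_p last_p le_p].
(* A transfer that leaves [s] unchanged is not an edge and is dropped from the path. *)
have [eq_su | neq_su] := eqVneq s (PartitionOf u_part).
  by exists p; rewrite eq_su leqW.
exists (PartitionOf u_part :: p); split=> //=; rewrite path_p andbT.
exact: (@transfer_adj _ _ _ i j).
Qed.

Lemma reachable_gdist (n r : nat) (s t : partition_of n) :
  reachable r s t -> gdist (@partition_adj n) s t <= r.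
Proof.
case/reachable_path=> p [path_p <- le_p].
exact: leq_trans (gdist_le_path path_p) le_p.
Qed.

Lemma reachable1_adj (n : nat) (s t : partition_of n) :
  reachable 1 s t -> s != t -> partition_adj s t.
Proof.
case/reachable_path=> [[|u [|v p]] [] //=]; first by move=> _ ->; rewrite eqxx.
by rewrite andbT => su <-.
Qed.

(** [reachable 1] tests for equality or adjacency, so the diagonal pairs pass as well. *)
Definition is_clique (n : nat) (c : seq (seq nat)) : bool :=
  [&& c != [::], uniq c, all (is_partition n) c
    & all (fun s => all (reachable 1 s) c) c].

Lemma omega_loc_ge (n : nat) (c : seq (seq nat)) : is_clique n c ->
  exists s : partition_of n, size c <= omega_loc (@partition_adj n) s.
Proof.
case/and4P=> c_neq0 c_uniq /allP c_part /allP c_adj.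
have [s s_c] : exists s, s \in c.
  case: c c_neq0 {c_uniq c_part c_adj} => // s c _.
  by exists s; apply: mem_head.
pose Q := [set t : partition_of n | parts t \in c].
exists (PartitionOf (c_part s s_c)); apply: leq_trans (_ : #|Q| <= _).
  rewrite cardE -(size_map (@parts n)); apply: uniq_leq_size => // t t_c.
  apply/mapP; exists (PartitionOf (c_part t t_c)) => //.
  by rewrite mem_enum inE.
apply: (bigmax_sup Q) => //; rewrite inE s_c andbT.
apply/forall_inP=> t; rewrite inE => t_c.
apply/forall_inP=> u; rewrite inE => u_c.
by apply/implyP; apply: reachable1_adj; apply: (allP (c_adj _ t_c)).
Qed.

(* Half of the L1 distance between two partitions of the same number. *)
Fixpoint excess (s t : seq nat) : nat :=
  match s, t with
  | x :: s', y :: t' => (x - y) + excess s' t'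
  | _, _ => sumn s
  end.

(* The partitions of r that equal their conjugate and have parts at most k,
   built by wrapping a symmetric hook around a smaller such partition. *)
Fixpoint self_conjugate (k r : nat) : seq (seq nat) :=
  if k is l.+1 then
    self_conjugate l r ++
    (if l.*2 < r then
       [seq k :: ([seq x.+1 | x <- s] ++ nseq (l - size s) 1)
       | s <- self_conjugate l (r - l.*2.+1)]
     else [::])
  else if r == 0 then [:: [::]] else [::].

(** The filter certifies every candidate; the hook construction only has to supply enough of
    them. *)
Definition axis_seq (n : nat) : seq (seq nat) :=
  [seq t <- self_conjugate n n | is_partition n t && (conjugate t == t)].

(* The comparison of [excess] spares most of the calls to [reachable]. *)
Definition near_axis (n r : nat) : pred (seq nat) := fun s =>
  has (fun t => (excess s t <= r) && reachable r s t) (axis_seq n).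

Lemma near_axisP (n r : nat) (s : partition_of n) : near_axis n r s ->
  exists2 t, t \in axis n & gdist (@partition_adj n) s t <= r.
Proof.
case/hasP=> t; rewrite mem_filter => /andP[/andP[t_part t_conj] _] /andP[_ st].
by exists (PartitionOf t_part); rewrite ?inE // reachable_gdist.
Qed.

(* A vertex of maximal degree, found by enumeration. *)
Definition degree_witness (n : nat) : seq nat := nth [::]
  [:: nil; [:: 1]; [:: 2]; [:: 2; 1]; [:: 3; 1]; [:: 3; 1; 1]; [:: 3; 2; 1];
   [:: 4; 2; 1]; [:: 4; 2; 1; 1]; [:: 5; 3; 1]; [:: 4; 3; 2; 1];
   [:: 5; 3; 2; 1]; [:: 5; 3; 2; 1; 1]; [:: 6; 4; 2; 1]; [:: 6; 4; 2; 1; 1];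
   [:: 5; 4; 3; 2; 1]; [:: 6; 4; 3; 2; 1]; [:: 6; 4; 3; 2; 1; 1];
   [:: 7; 5; 3; 2; 1]; [:: 7; 5; 3; 2; 1; 1]; [:: 8; 5; 3; 2; 1; 1];
   [:: 6; 5; 4; 3; 2; 1]; [:: 7; 5; 4; 3; 2; 1]; [:: 7; 5; 4; 3; 2; 1; 1];
   [:: 8; 6; 4; 3; 2; 1]; [:: 8; 6; 4; 3; 2; 1; 1]; [:: 9; 6; 4; 3; 2; 1; 1];
   [:: 8; 6; 4; 3; 2; 2; 1; 1]; [:: 7; 6; 5; 4; 3; 2; 1];
   [:: 8; 6; 5; 4; 3; 2; 1]; [:: 8; 6; 5; 4; 3; 2; 1; 1]] n.

(* A largest clique: put a long row on top of the staircase (k, ..., 1), and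
   move its last box to each of the other rows, or to a new row. *)
Definition clique_witness (n : nat) : seq (seq nat) :=
  let k := count (fun d => triangle d < n) (iota 2 n) in
  let s := (n - triangle k) :: rev (iota 1 k) in
  undup (s :: [seq transfer 0 j s | j <- iota 1 k.+1]).

(** A maximizer of [omega_loc] has at least [size c - 2] distinct parts by [line_bound_le]. The
    inequality between [d] and [delta] gives maximizers of the degree equally many, so one
    enumeration serves both. *)
Definition check (n : nat) : bool :=
  let w := degree_witness n in
  let c := clique_witness n in
  let delta := size (neighbors w) in
  let d := size c - 2 in
  [&& is_partition n w, is_clique n c, (d == 0) || (d.-1 * d < delta)
    & all (fun s => ((degree_bound s < delta) || near_axis n 2 s) &&
                    (((line_bound s).+1 < size c) || near_axis n 4 s))
          (partitions n n d)].

(** * From the computed check to the radii *)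

Lemma part_le (n : nat) (s : partition_of n) : all (fun x => x <= n) s.
Proof.
have /and3P[_ _ /eqP s_sum] := valP s; apply/allP=> x s_x.
by rewrite -[n]s_sum -(nth_index 0 s_x) leq_nth_sumn.
Qed.

Lemma partition_of_enum (n d : nat) (s : partition_of n) :
  d <= size (undup s) -> parts s \in partitions n n d.
Proof.
have /and3P[s_sorted s_pos /eqP s_sum] := valP s.
move=> le_d; rewrite -[in X in partitions _ X]s_sum.
exact: mem_partitions (part_le s) le_d.
Qed.

Lemma check_near_axis (n : nat) (s : partition_of n) : check n ->
  ((forall t, degree (@partition_adj n) t <= degree (@partition_adj n) s) ->
     near_axis n 2 s) /\
  ((forall t,
      omega_loc (@partition_adj n) t <= omega_loc (@partition_adj n) s) ->
     near_axis n 4 s).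
Proof.
rewrite /check; set w := degree_witness n; set c := clique_witness n.
set delta := size (neighbors w); set d := size c - 2.
case/and4P=> w_part /omega_loc_ge[v le_c] small_d /allP near.
have many_parts : d <= size (undup s) -> parts s \in partitions n n d.
  exact: partition_of_enum.
split=> s_max.
  have le_delta : delta <= degree_bound s.
    apply: leq_trans (degree_le s).
    apply: leq_trans (s_max (PartitionOf w_part)).
    exact: (degree_ge (PartitionOf w_part)).
  suff /many_parts/near/andP[+ _] : d <= size (undup s).
    by rewrite ltnNge le_delta.
  (* With k distinct parts, [delta] is at most k (k + 1), but it exceeds (d - 1) d unless d = 0; so
     k is at least d. *)
  move: small_d (leq_trans le_delta (degree_bound_le s)); clear.
  by move: (size (undup s)) delta => k e; nia.
have le_line : size c <= (line_bound s).+1.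
  exact: leq_trans le_c (leq_trans (s_max v) (omega_loc_le s)).
suff /many_parts/near/andP[_] : d <= size (undup s) by rewrite ltnNge le_line.
by have := line_bound_le s; rewrite /d; lia.
Qed.

(** Any superset of the axis is allowed, so that the axis and the thin spine are treated at once. *)
Lemma check_radius (n : nat) (S : {set partition_of n}) :
  check n -> axis n \subset S ->
  [/\ radius (@partition_adj n) S (degree (@partition_adj n)) <= 2,
      radius (@partition_adj n) S (omega_loc (@partition_adj n)) <= 4
    & radius (@partition_adj n) S (dim_loc (@partition_adj n)) <= 4].
Proof.
move=> n_check /subsetP sub_axis.
have near r (s : partition_of n) : near_axis n r s ->
    exists2 t, t \in S & gdist (@partition_adj n) s t <= r.
  by case/near_axisP=> t /sub_axis; exists t.
split; apply: radius_le => s s_max; apply: near.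
- by have [+ _] := check_near_axis s n_check; apply.
- by have [_] := check_near_axis s n_check; apply.
- have [_] := check_near_axis s n_check; apply=> t.
  by rewrite -dim_loc_le.
Qed.

(** The only number in the range without a self-conjugate partition; there [check] fails for lack of
    targets. *)
Lemma axial2 : axial 2 = false.
Proof.
apply/negbTE; rewrite negbK; apply/eqP/setP=> s; rewrite !inE; apply/negbTE.
have : all (fun s => conjugate s != s) (partitions 2 2 0) by [].
by move/allP; apply; apply: partition_of_enum.
Qed.

Lemma check_range : all (fun n => (n == 2) || check n) (iota 1 30).
Proof. by vm_compute. Qed.

Theorem theorem5p3 (n : nat) (n_axial : axial n) (n_range : 1 <= n <= 30) :
  [/\ rho_ax (degree (@partition_adj n)) <= 2 /\
      rho_sp (degree (@partition_adj n)) <= 2,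
      rho_ax (omega_loc (@partition_adj n)) <= 4 /\
      rho_sp (omega_loc (@partition_adj n)) <= 4
    & rho_ax (dim_loc (@partition_adj n)) <= 4 /\
      rho_sp (dim_loc (@partition_adj n)) <= 4].
Proof.
have n_check : check n.
  have : n \in iota 1 30 by rewrite mem_iota.
  by case/(allP check_range)/predU1P=> [n2 | //]; rewrite n2 axial2 in n_axial.
have [ax_deg ax_omega ax_dim] := check_radius n_check (subxx (axis n)).
have sub_spine : axis n \subset thin_spine n by apply: subsetUl.
by have [] := check_radius n_check sub_spine.
Qed.
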